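(* Let $d\ge 1$ and let $f:\mathbb{R}^d\to\mathbb{R}$ be a convex $C^1$-function which has a minimizer. Then every gradient flow $x:[0,\infty)\to\mathbb{R}^d$, $t\mapsto x_t$, of $f$ satisfies \[ \liminf_{t\to\infty}\Big(t\cdot\log^2(t)\cdot\big(f(x_t)-\inf f\big)\Big)=0. \]
   Context: A gradient flow of a $C^1$-function $f$ is a differentiable curve $x:[0,\infty)\to\mathbb{R}^d$ satisfying $\dot x_t=-\nabla f(x_t)$ for all $t\ge 0$. Here $\log^2(t)=(\log t)^2$. *)

(* Defs.v *)
From mathcomp Require Import all_boot all_order all_algebra.
From mathcomp Require Import all_classical all_reals all_analysis.

Set Implicit Arguments.
Unset Strict Implicit.
Unset Printing Implicit Defensive.

Import Order.TTheory GRing.Theory Num.Theory.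
Import numFieldNormedType.Exports.

Local Open Scope classical_set_scope.
Local Open Scope ring_scope.

(* Row vectors 'rV[R]_d carry the sup norm; as all norms on R^d are equivalent,
   the notions below do not depend on this choice.  The gradient is the one
   for the Euclidean inner product. *)

Definition gradient (R : realType) (d : nat) (f : 'rV[R]_d -> R)
    (p : 'rV[R]_d) : 'rV[R]_d :=
  \row_(i < d) 'D_(delta_mx 0 i) f p.

Definition C1_function (R : realType) (d : nat) (f : 'rV[R]_d -> R) : Prop :=
  (forall p, differentiable f p) /\ continuous (gradient f).

Definition has_minimizer (T : Type) (R : realType) (f : T -> R) : Prop :=
  exists p, forall q, f p <= f q.

(* A curve [0, +oo) -> R^d is encoded by a total function whose values at
   negative times are irrelevant: difference quotients are taken within
   [0, +oo), so that the derivative at t = 0 is the right derivative. *)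
Definition is_gradient_flow (R : realType) (d : nat) (f : 'rV[R]_d -> R)
    (x : R -> 'rV[R]_d) : Prop :=
  forall t : R, 0 <= t ->
    (s - t)^-1 *: (x s - x t) @[s --> within `[0, +oo[ t^']
      --> - gradient f (x t).

(* Main.v *)
Require Import Defs.
From mathcomp Require Import all_boot all_order all_algebra.
From mathcomp Require Import all_classical all_reals all_analysis.
From mathcomp Require Import lra ring zify.

Import Order.TTheory GRing.Theory Num.Theory.
Import numFieldNormedType.Exports.

Local Open Scope classical_set_scope.
Local Open Scope ring_scope.

(** Sampled at the times 2^i, the flow is a bounded self-contracted sequence, so
    in finite dimension it has finite length.  Differentiating |x_s - x_u|^2
    and using convexity gives, for s <= t <= u,
      2 (t - s) (f x_t - f x_u) <= |x_s - x_u|^2.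
    With s, t, u = 2^(i-1), 2^i, 2^(i+1) and b_i = f x_{2^i} - inf f this reads
    2^i (b_i - b_{i+1}) <= |x_{2^(i+1)} - x_{2^(i-1)}|^2, so that
    s_i = sqrt (2^i b_i) satisfies s_i <= K |x_{2^(i+1)} - x_{2^(i-1)}| + 3/4 s_{i+1}
    and is summable.  A positive liminf would force s_i >= c / i for large i,
    contradicting the divergence of the harmonic series. *)

(** * Euclidean inner product versus sup norm *)

Definition dot {R : realType} {d : nat} (u v : 'rV[R]_d) : R :=
  \sum_(i < d) u 0 i * v 0 i.

Section dot_product.
Context {R : realType} {d : nat}.
Implicit Types u v w : 'rV[R]_d.

Lemma dotC u v : dot u v = dot v u.
Proof. by apply: eq_bigr => i _; rewrite mulrC. Qed.

Lemma dotDl u v w : dot (u + v) w = dot u w + dot v w.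
Proof. by rewrite -big_split; apply: eq_bigr => i _; rewrite mxE mulrDl. Qed.

Lemma dotZl (a : R) u v : dot (a *: u) v = a * dot u v.
Proof. by rewrite /dot mulr_sumr; apply: eq_bigr => i _; rewrite mxE mulrA. Qed.

Lemma dotNl u v : dot (- u) v = - dot u v.
Proof. by rewrite -scaleN1r dotZl mulN1r. Qed.

Lemma dotBl u v w : dot (u - v) w = dot u w - dot v w.
Proof. by rewrite dotDl dotNl. Qed.

Lemma dotBr u v w : dot w (u - v) = dot w u - dot w v.
Proof. by rewrite !(dotC w) dotBl. Qed.

Lemma dotZr (a : R) u v : dot u (a *: v) = a * dot u v.
Proof. by rewrite !(dotC u) dotZl. Qed.

Lemma dot0l v : dot 0 v = 0.
Proof. by apply: big1 => i _; rewrite mxE mul0r. Qed.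

Lemma dot_suml (I : Type) (s : seq I) (P : pred I) (F : I -> 'rV[R]_d) v :
  dot (\sum_(i <- s | P i) F i) v = \sum_(i <- s | P i) dot (F i) v.
Proof.
apply: (big_morph (fun u => dot u v)); last exact: dot0l.
by move=> u w; exact: dotDl.
Qed.

Lemma normr_coord_le u j : `|u 0 j| <= `|u|.
Proof. by rewrite [leRHS]/Num.norm/= mx_normrE; exact: (le_bigmax _ _ (0, j)). Qed.

Lemma rV_norm_le u (r : R) : 0 <= r -> (forall j, `|u 0 j| <= r) -> `|u| <= r.
Proof.
move=> r0 ur; rewrite [leLHS]/Num.norm/= mx_normrE.
by apply: bigmax_le => // -[i j] _ /=; rewrite ord1.
Qed.

(** Stands in for Cauchy-Schwarz; the factor [d] paid for the sup norm only affects constants. *)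
Lemma normr_dot_le u v : `|dot u v| <= d%:R * `|u| * `|v|.
Proof.
apply: le_trans (ler_norm_sum _ _ _) _.
rewrite (_ : d%:R * `|u| * `|v| = \sum_(i < d) `|u| * `|v|); last first.
  by rewrite sumr_const card_ord -mulrA mulr_natl.
by apply: ler_sum => i _; rewrite normrM ler_pM // normr_coord_le.
Qed.

Lemma dot_ge_norm u : `|u| ^+ 2 <= dot u u.
Proof.
have dotuu : dot u u = \sum_(i < d) `|u 0 i| ^+ 2.
  by apply: eq_bigr => i _; rewrite real_normK ?num_real // expr2.
have dot0 : 0 <= dot u u by rewrite dotuu; apply: sumr_ge0 => i _; exact: sqr_ge0.
rewrite -[leRHS]sqr_sqrtr // ler_sqr ?nnegrE ?sqrtr_ge0 //.
apply: rV_norm_le => [|j]; first exact: sqrtr_ge0.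
rewrite -(@ler_sqr R) ?nnegrE ?sqrtr_ge0 // sqr_sqrtr // dotuu (bigD1 j) //=.
by rewrite lerDl; apply: sumr_ge0 => i _; exact: sqr_ge0.
Qed.

End dot_product.

(** * Finite nets and finitely many test directions *)

Section finite_directions.
Context {R : realType} (d : nat).
Implicit Types u v : 'rV[R]_d.

(** The net is the grid of mesh [e] with lowest corner [-r]; each coordinate is rounded down to
    it. *)
Lemma rV_ball_finite_net (r e : R) : 0 <= r -> 0 < e ->
  exists (I : finType) (z : I -> 'rV[R]_d),
    forall v, `|v| <= r -> exists i, `|v - z i| <= e.
Proof.
move=> r0 e0; pose n := Num.truncn ((r + r) / e).
exists {ffun 'I_d -> 'I_n.+1},
  (fun k : {ffun 'I_d -> 'I_n.+1} => \row_j ((k j)%:R * e - r)) => v vr.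
exists [ffun j => inord (Num.truncn ((v 0 j + r) / e))].
apply: rV_norm_le => [|j]; first exact: ltW.
have /ler_normlP [vr1 vr2] := le_trans (normr_coord_le v j) vr.
have a0 : 0 <= (v 0 j + r) / e by rewrite divr_ge0 ?(ltW e0) //; lra.
have le_n : (Num.truncn ((v 0 j + r) / e)%R < n.+1)%N.
  by rewrite ltnS; apply: le_truncn; rewrite ler_pM2r ?invr_gt0 // lerD2r.
rewrite !mxE ffunE inordK //.
have /andP[] := truncn_itv a0; set m := Num.truncn _.
rewrite ler_pdivlMr // ltr_pdivrMr // -natr1 mulrDl mul1r => m1 m2.
by apply/ler_normlP; split; lra.
Qed.

(* Vectors at pairwise non-obtuse angles lie in a cone around the sum of
   representatives of the classes of a finite net that they meet: each of them
   is close to one summand and makes a non-obtuse angle with the others. *)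
Lemma finite_directions :
  exists (I : finType) (z : I -> 'rV[R]_d), forall Q : set 'rV[R]_d,
    (forall q q', Q q -> Q q' -> 0 <= dot q q') ->
    exists i, forall q, Q q -> 4^-1 * `|q| <= dot (z i) q.
Proof.
(* In [dot_y] three errors of size [d * e <= 1/4] are subtracted from [dot u u >= 1]: two from
   replacing [u] by [w i], one from the second net. *)
pose e : R := (4 * d.+1%:R)^-1.
have e0 : 0 < e by rewrite invr_gt0 mulr_gt0.
have de : d%:R * e <= 4^-1.
  by rewrite ler_pdivrMr ?mulr_gt0 // mulKf // ler_nat.
have [I [z net1]] := rV_ball_finite_net 1 e ler01 e0.
(* The sum of representatives depends on [Q], so it is rounded to a second net, on a ball containing
   all such sums. *)
have [J [y net2]] := rV_ball_finite_net #|I|%:R e (ler0n _ _) e0.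
exists J, y => Q dotQ.
pose U : set 'rV[R]_d := [set `|q|^-1 *: q | q in [set q | Q q /\ q != 0]].
have normU u : U u -> `|u| = 1.
  move=> [q [_ q0] <-]; rewrite normrZ normfV normr_id mulVf //.
  by rewrite normr_eq0.
have dotU u v : U u -> U v -> 0 <= dot u v.
  move=> [q [Qq _] <-] [q' [Qq' _] <-]; rewrite dotZl dotZr.
  by rewrite !mulr_ge0 ?invr_ge0 //; exact: dotQ.
(* Classes that [U] does not meet get the default [0], which adds nothing to the sum. *)
pose w i := xget 0 [set u | U u /\ `|u - z i| <= e].
have wP i : (w i = 0) \/ (U (w i) /\ `|w i - z i| <= e).
  by rewrite /w; case: xgetP => [x _ []|_]; [right|left].
have normw i : `|w i| <= 1 by case: (wP i) => [->|[/normU-> //]]; rewrite normr0.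
have dotw i u : U u -> 0 <= dot (w i) u.
  by move=> Uu; case: (wP i) => [->|[Uw _]]; [rewrite dot0l|exact: dotU].
have normW : `|\sum_i w i| <= #|I|%:R.
  apply: le_trans (ler_norm_sum _ _ _) _.
  by rewrite -sum1_card natr_sum; apply: ler_sum => i _; exact: normw.
have [j yj] := net2 _ normW.
have dot_y u : U u -> 4^-1 <= dot (y j) u.
  move=> Uu; have u1 := normU _ Uu.
  have [i ui] := net1 u ltac:(by rewrite u1).
  have [Uwi wi] : U (w i) /\ `|w i - z i| <= e.
    by apply: (xgetPex 0 (P := [set u | U u /\ `|u - z i| <= e])); exists u; split.
  have wiu : `|u - w i| <= e + e.
    rewrite -(subrKA (z i)) (le_trans (ler_normD _ _)) // lerD //.
    by rewrite distrC.
  have sum_ge : dot (w i) u <= dot (\sum_i w i) u.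
    rewrite dot_suml (bigD1 i) //= lerDl.
    by apply: sumr_ge0 => k _; exact: dotw.
  have := dot_ge_norm u; rewrite u1 expr1n => uu1.
  have /ler_normlP [_] := normr_dot_le (u - w i) u.
  have /ler_normlP [_] := normr_dot_le (\sum_i w i - y j) u.
  rewrite u1 !mulr1 !dotBl => h1 h2.
  have h3 := ler_wpM2l (ler0n R d) yj.
  have h4 := ler_wpM2l (ler0n R d) wiu.
  by rewrite mulrDr in h4; lra.
exists j => q Qq; have [->|q0] := eqVneq q 0.
  by rewrite normr0 mulr0 dotC dot0l.
have := dot_y (`|q|^-1 *: q) _; rewrite dotZr => H.
have q0' : 0 < `|q| by rewrite normr_gt0.
rewrite mulrC -ler_pdivlMl //; apply: H; by exists q.
Qed.

End finite_directions.

(** * Self-contracted sequences and finite length *)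

Section self_contracted.
Context {R : realType} {d : nat}.
Implicit Types p : nat -> 'rV[R]_d.

(** Expand the square of [b - c = (b - a) - (c - a)]; the square of [c - a] cancels. *)
Lemma dot_closer (a b c : 'rV[R]_d) :
  dot (b - c) (b - c) <= dot (a - c) (a - c) ->
  dot (b - a) (b - a) <= 2 * dot (b - a) (c - a).
Proof.
rewrite !dotBl !dotBr (dotC c a) (dotC c b) (dotC b a); lra.
Qed.

Definition self_contracted p := forall i j k, (i <= j <= k)%N ->
  dot (p j - p k) (p j - p k) <= dot (p i - p k) (p i - p k).

(* As i grows, the support functions of the tails {p j | i <= j} decrease; the
   sum of their values over finitely many directions loses at each step a
   fixed fraction of the length of that step. *)
Lemma self_contracted_finite_length p (B : R) :
  self_contracted p -> (forall i, `|p i| <= B) ->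
  exists C, forall n, \sum_(i < n) `|p i.+1 - p i| <= C.
Proof.
move=> selfp pB; have [I [z dirs]] := @finite_directions R d.
pose M k := d%:R * `|z k| * B.
(* The sign makes [sup (S i k)] the support function in direction [- z k], in which [p i] will lead
   all later points. *)
pose S i k := [set - dot (z k) (p j) | j in [set j | (i <= j)%N]].
have dotM k j : `|- dot (z k) (p j)| <= M k.
  by rewrite normrN (le_trans (normr_dot_le _ _)) // ler_wpM2l.
have S_nonempty i k : S i k !=set0 by exists (- dot (z k) (p i)); exists i => /=.
have S_ub i k : has_ubound (S i k).
  by exists (M k) => _ [j _ <-]; case/ler_normlP: (dotM k j).
have in_S i j k : (i <= j)%N -> S i k (- dot (z k) (p j)) by move=> ij; exists j.
have S_norm i k : `|sup (S i k)| <= M k.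
  apply/ler_normlP; split.
    have /ler_normlP [h _] := dotM k i.
    rewrite lerNl; apply: le_trans (ub_le_sup (S_ub _ _) (in_S i i k (leqnn i))).
    by rewrite lerNl.
  apply: ge_sup => // _ [j _ <-]; by case/ler_normlP: (dotM k j).
(* A factor [2 * d] comes from [dot_closer] and [normr_dot_le], a factor 4 from [finite_directions];
   [d.+1] keeps [D] positive. *)
pose D : R := 8 * d.+1%:R.
have D0 : 0 < D by rewrite mulr_gt0.
pose Phi i := \sum_k sup (S i k).
have step i : `|p i.+1 - p i| <= D * (Phi i - Phi i.+1).
  pose Q : set 'rV[R]_d := [set p j - p i | j in [set j | (i < j)%N]].
  (* By self-contraction at [i <= j <= l], [dot_closer] bounds a square by twice this inner
     product. *)
  have dotQ u v : Q u -> Q v -> 0 <= dot u v.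
    move=> [j ij <-] [l il <-] /=.
    wlog jl : j l ij il / (j <= l)%N.
      by move=> H; case/orP: (leq_total j l) => jl; [|rewrite dotC]; exact: H.
    have ijl : (i <= j <= l)%N by rewrite jl ltnW.
    have := dot_closer _ _ _ (selfp _ _ _ ijl).
    have := dot_ge_norm (p j - p i); have := sqr_ge0 `|p j - p i|; lra.
  have [k dir_k] := dirs Q dotQ.
  (* With [i.+1] as middle index, cancelling one factor [|q|] bounds the step by [2 * d] times any
     later displacement from [p i]. *)
  have long j : (i < j)%N -> `|p i.+1 - p i| <= D * dot (z k) (p j - p i).
    move=> ij; have dir_j : 4^-1 * `|p j - p i| <= dot (z k) (p j - p i).
      by apply: dir_k; exists j.
    have iij : (i <= i.+1 <= j)%N by rewrite leqnSn.
    have := dot_closer _ _ _ (selfp _ _ _ iij).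
    set q := p i.+1 - p i => h1; have h2 := dot_ge_norm q.
    have /ler_normlP [_ h3] := normr_dot_le q (p j - p i).
    have h4 : `|q| * `|q| <= `|q| * (2 * d%:R * `|p j - p i|).
      by rewrite -expr2; lra.
    apply: (@le_trans _ _ (2 * d%:R * `|p j - p i|)).
      have [->|q0] := eqVneq q 0; first by rewrite normr0 !mulr_ge0.
      by rewrite ler_pM2l ?normr_gt0 // in h4.
    apply: (@le_trans _ _ (D * (4^-1 * `|p j - p i|))); last by rewrite ler_pM2l.
    rewrite mulrA ler_wpM2r // /D -natr1; lra.
  have nonincr l : sup (S i.+1 l) <= sup (S i l).
    apply: ge_sup => // _ [j /= ij <-].
    by apply: ub_le_sup => //; apply: in_S; exact: ltnW.
  have drop : sup (S i.+1 k) <= sup (S i k) - D^-1 * `|p i.+1 - p i|.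
    apply: ge_sup => // _ [j /= ij <-].
    have := ub_le_sup (S_ub _ _) (in_S i i k (leqnn i)).
    have := long j ij; rewrite -ler_pdivrMl // dotBr; lra.
  rewrite -ler_pdivrMl // /Phi -sumrB (bigD1 k) //=.
  have : 0 <= \sum_(l | l != k) (sup (S i l) - sup (S i.+1 l)).
    by apply: sumr_ge0 => l _; rewrite subr_ge0.
  lra.
exists (D * (\sum_k M k + \sum_k M k)) => n.
apply: (@le_trans _ _ (\sum_(i < n) D * (Phi i - Phi i.+1))).
  by apply: ler_sum => i _.
have -> : \sum_(i < n) D * (Phi i - Phi i.+1) = D * (Phi 0%N - Phi n).
  rewrite -mulr_sumr; congr (_ * _).
  elim: n => [|n IH]; first by rewrite big_ord0 subrr.
  by rewrite big_ord_recr /= IH; ring.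
have normPhi i : `|Phi i| <= \sum_k M k.
  by apply: le_trans (ler_norm_sum _ _ _) _; apply: ler_sum => k _.
have /ler_normlP [_ h0] := normPhi 0%N.
have /ler_normlP [hn _] := normPhi n.
by rewrite ler_pM2l //; lra.
Qed.

End self_contracted.

(** * Gradient inequality and mean value bound *)

Section gradient.
Context {R : realType} {d : nat}.
Implicit Types (f : 'rV[R]_d -> R) (p q v : 'rV[R]_d).

Lemma deriveE_gradient f p v :
  differentiable f p -> 'D_v f p = dot (gradient f p) v.
Proof.
move=> df; rewrite deriveE // [in LHS](row_sum_delta v) linear_sum.
apply: eq_bigr => i _; rewrite linearZ /= mxE deriveE // mulrC; congr (_ * _).
Qed.

(** Convexity bounds the difference quotients along the segment by [f q - f p] for [0 < h <= 1]; let
    [h] tend to 0 from the right. *)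
Lemma convex_gradient_le f p q :
  convex_function [set: convex_lmodType 'rV[R]_d] f -> differentiable f p ->
  dot (gradient f p) (q - p) <= f q - f p.
Proof.
move=> cf df; rewrite -deriveE_gradient //.
have dfv : derivable f p (q - p) by exact: diff_derivable.
have lim_f := cvg_dnbhs_at_right dfv.
apply: (cvgr_to_le lim_f).
near=> h.
have h0 : 0 < h by near: h; exact: nbhs_right_gt.
have h1 : h <= 1 by near: h; exact: nbhs_right_le.
have := cf (Itv01 (ltW h0) h1) q p; rewrite !inE => /(_ I I).
rewrite convRE /conv /= /unstable.onem.
have -> : h *: q + (1 - h) *: p = h *: (q - p) + p.
  by rewrite scalerBl scale1r scalerBr addrCA addrC.
by move=> fh; rewrite ler_pdivrMl //; lra.
Unshelve. all: by end_near.
Qed.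

Lemma is_derive_increment_le (h dh : R -> R) (a b c : R) : a <= b ->
  (forall r, a <= r <= b -> is_derive r 1 h (dh r) /\ dh r <= c) ->
  h b - h a <= c * (b - a).
Proof.
move=> ab hc; have [||r] := @MVT_segment _ h dh a b ab.
- by move=> r; rewrite in_itv /= => /andP[ar rb]; apply: (hc r _).1; rewrite !ltW.
- apply: derivable_within_continuous => r; rewrite in_itv /= => /hc[dhr _].
  exact: ex_derive.
by rewrite in_itv /= => /hc[_ dhc] ->; rewrite ler_wpM2r // subr_ge0.
Qed.

End gradient.

(** * Energy and distance estimates along the flow *)

Section gradient_flow.
Context {R : realType} {d : nat} (f : 'rV[R]_d -> R) (x : R -> 'rV[R]_d).
Hypothesis f_convex : convex_function [set: convex_lmodType 'rV[R]_d] f.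
Hypothesis f_diff : forall p, differentiable f p.
Hypothesis x_flow : is_gradient_flow f x.

(** Increments with [|h| < t] stay in [[0, +oo)], so the restricted limit is a two-sided one. *)
Lemma flow_is_derive (t : R) : 0 < t -> is_derive t 1 x (- gradient f (x t)).
Proof.
move=> t0; have lim_x : h^-1 *: (x (h *: 1 + t) - x t) @[h --> 0^'] -->
    - gradient f (x t).
  apply/cvgrPdist_le => e e0.
  have /cvgrPdist_le/(_ e e0) := x_flow t (ltW t0).
  move=> -[r /= r0 xr].
  near=> h.
  have hr : `|h| < r by near: h; exact: dnbhs0_lt.
  have ht : `|h| < t by near: h; exact: dnbhs0_lt.
  have h0 : h != 0 by near: h; exact: nbhs_dnbhs_neq.
  have := xr (h + t); rewrite /= /ball_ /= opprD addrCA subrr addr0 normrN.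
  move=> /(_ hr).
  rewrite addrK [h *: 1]mulr1; apply.
    by rewrite -subr_eq0 addrK.
  by rewrite in_itv /= andbT; case/ltr_normlP: ht; lra.
split; first by apply: cvgP; exact: lim_x.
by apply: cvg_lim.
Unshelve. all: by end_near.
Qed.

Lemma flow_energy_is_derive (t : R) : 0 < t ->
  is_derive t 1 (f \o x) (- dot (gradient f (x t)) (gradient f (x t))).
Proof.
move=> t0; have [dx xE] := flow_is_derive _ t0.
have diffx : differentiable x t by exact/derivable1_diffP.
have difffx : differentiable (f \o x) t by exact: differentiable_comp.
split; first exact/derivable1_diffP.
rewrite deriveE // diff_comp //= -[X in 'd f _ X]deriveE // xE.
by rewrite -deriveE // deriveE_gradient // dotC dotNl.
Qed.

Lemma flow_dist_is_derive y (t : R) : 0 < t ->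
  is_derive t 1 (fun s => dot (x s - y) (x s - y))
    (- 2 * dot (gradient f (x t)) (x t - y)).
Proof.
move=> t0; have [dx xE] := flow_is_derive _ t0.
have coordE i : is_derive t 1 (fun s => x s 0 i) (- gradient f (x t) 0 i).
  split; first exact: (derivable_mxP _ _ _).1.
  by move: xE; rewrite derive_mx // => /matrixP/(_ 0 i); rewrite !mxE.
pose h i s := (x s 0 i - y 0 i) ^+ 2.
have -> : (fun s => dot (x s - y) (x s - y)) = \sum_(i < d) h i.
  apply/funext => s; rewrite fct_sumE; apply: eq_bigr => i _.
  by rewrite /h expr2 !mxE.
apply: is_derive_eq.
rewrite /dot mulr_sumr; apply: eq_bigr => i _.
by rewrite !mxE /GRing.scale /=; ring.
Qed.

Lemma flow_energy_nonincreasing (s t : R) : 0 < s -> s <= t -> f (x t) <= f (x s).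
Proof.
move=> s0 st; rewrite -subr_le0 -(mul0r (t - s)).
apply: (is_derive_increment_le (f \o x) _ _ _ _ st) => r /andP[sr _].
split; first exact: flow_energy_is_derive (lt_le_trans s0 sr).
by rewrite oppr_le0 (le_trans (sqr_ge0 _) (dot_ge_norm _)).
Qed.

(** By convexity, half the derivative of the squared distance to [y] is at most [f y - f (x r)]. The
    next three estimates are choices of [y] and [c]. *)
Lemma flow_dist_increment_le y (s t c : R) : 0 < s -> s <= t ->
  (forall r, s <= r <= t -> f y - f (x r) <= c) ->
  dot (x t - y) (x t - y) <= dot (x s - y) (x s - y) + 2 * c * (t - s).
Proof.
move=> s0 st yc; rewrite -lerBlDl.
apply: (is_derive_increment_le (fun s => dot (x s - y) (x s - y)) _ _ _ _ st).
move=> r srt; have /andP[sr _] := srt.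
split; first exact: flow_dist_is_derive (lt_le_trans s0 sr).
have := convex_gradient_le f (x r) y f_convex (f_diff _).
have := yc r srt; rewrite !dotBr; lra.
Qed.

Lemma flow_self_contracted (s t u : R) : 0 < s -> s <= t -> t <= u ->
  dot (x t - x u) (x t - x u) <= dot (x s - x u) (x s - x u).
Proof.
move=> s0 st tu; have := @flow_dist_increment_le (x u) s t 0 s0 st.
rewrite mulr0 mul0r addr0; apply => r /andP[sr rt].
rewrite subr_le0 flow_energy_nonincreasing ?(lt_le_trans s0) //.
exact: le_trans tu.
Qed.

(** Take [y = x u] and [c = f (x u) - f (x t)], since the energy on [[s, t]] is lowest at [t]; then
    drop the square on the left. *)
Lemma flow_energy_drop_le (s t u : R) : 0 < s -> s <= t -> t <= u ->
  2 * (t - s) * (f (x t) - f (x u)) <= dot (x s - x u) (x s - x u).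
Proof.
move=> s0 st tu.
have H : dot (x t - x u) (x t - x u) <=
    dot (x s - x u) (x s - x u) + 2 * (f (x u) - f (x t)) * (t - s).
  apply: flow_dist_increment_le => // r /andP[sr rt].
  by rewrite lerD2l lerN2 flow_energy_nonincreasing // (lt_le_trans s0).
have := le_trans (sqr_ge0 _) (dot_ge_norm (x t - x u)); lra.
Qed.

(** For a minimizer [y] both terms on the left are nonnegative: one bounds the orbit, the other the
    energy gap by a multiple of [1 / (t - s)]. *)
Lemma flow_energy_gap_le y (s t : R) : 0 < s -> s <= t ->
  dot (x t - y) (x t - y) + 2 * (t - s) * (f (x t) - f y) <=
  dot (x s - y) (x s - y).
Proof.
move=> s0 st.
have : dot (x t - y) (x t - y) <=
    dot (x s - y) (x s - y) + 2 * (f y - f (x t)) * (t - s).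
  apply: flow_dist_increment_le => // r /andP[sr rt].
  by rewrite lerD2l lerN2 flow_energy_nonincreasing // (lt_le_trans s0).
lra.
Qed.

End gradient_flow.

(** * Summability and harmonic comparison for real sequences *)

Section real_sequences.
Context {R : realType}.
Implicit Types s u : nat -> R.

(** Shifting the index raises the sum by at most [M], so three quarters of it are absorbed on the
    left. *)
Lemma bounded_sum_of_contraction s u (K C M : R) : 0 <= K ->
  (forall i, s i <= K * u i + 3 / 4 * s i.+1) ->
  (forall n, \sum_(i < n) u i <= C) ->
  (forall i, 0 <= s i <= M) ->
  forall n, \sum_(i < n) s i <= 4 * (K * C + M).
Proof.
move=> K0 su uC sM n.
have shift : \sum_(i < n) s i.+1 = \sum_(i < n) s i + s n - s 0%N.
  elim: n => [|n IH]; first by rewrite !big_ord0; ring.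
  by rewrite !big_ord_recr /= IH; ring.
have : \sum_(i < n) s i <= \sum_(i < n) (K * u i + 3 / 4 * s i.+1).
  by apply: ler_sum => i _.
rewrite big_split /= -!mulr_sumr shift.
have := ler_wpM2l K0 (uC n).
have /andP[s0 _] := sM 0%N; have /andP[_ sn] := sM n; have /andP[s0' _] := sM n.
lra.
Qed.

Lemma sum_ge_harmonic_unbounded u (N : nat) (C : R) : (forall i, 0 <= u i) ->
  (forall i, (N <= i)%N -> harmonic i <= u i) ->
  ~ (forall n, \sum_(i < n) u i <= C).
Proof.
move=> u0 uN uC; apply: (@dvg_harmonic R).
have nd : nondecreasing_seq (series (@harmonic R)).
  by apply: nondecreasing_series => i _ _; exact: harmonic_ge0.
apply: nondecreasing_is_cvgn => //; exists (series harmonic N + C) => _ [n _ <-].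
apply: (@le_trans _ _ (series harmonic N + \sum_(i < n) u i)); last first.
  by rewrite lerD2l.
elim: n => [|n IH].
  by rewrite big_ord0 addr0; exact: nd.
rewrite big_ord_recr /=; case: (leqP N n) => Nn.
  by rewrite seriesSr addrA lerD // uN.
apply: (@le_trans _ _ (series harmonic N)); first exact: nd.
by rewrite lerDl addr_ge0 // sumr_ge0.
Qed.

End real_sequences.

(** * Energy decay at dyadic times *)

Section energy_decay.
Context {R : realType} {d : nat} (f : 'rV[R]_d -> R) (x : R -> 'rV[R]_d).
Hypothesis f_convex : convex_function [set: convex_lmodType 'rV[R]_d] f.
Hypothesis f_diff : forall p, differentiable f p.
Hypothesis x_flow : is_gradient_flow f x.
Variable z : 'rV[R]_d.
Hypothesis z_min : forall q, f z <= f q.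

Let p i := x (2 ^+ i).
Let E := dot (x 1 - z) (x 1 - z).

Let exp2_gt0 i : 0 < 2 ^+ i :> R.
Proof. exact: exprn_gt0. Qed.

Let exp2_ge1 i : 1 <= 2 ^+ i :> R.
Proof. by rewrite exprn_ege1 // ler1n. Qed.

Let le_exp2 i j : (i <= j)%N -> 2 ^+ i <= 2 ^+ j :> R.
Proof. by move=> ij; rewrite ler_weXn2l // ler1n. Qed.

Lemma flow_dyadic_finite_length :
  exists C, forall n, \sum_(i < n) `|p i.+1 - p i| <= C.
Proof.
have p_self : self_contracted p.
  move=> i j k /andP[ij jk].
  by apply: (flow_self_contracted f x f_convex f_diff x_flow) => //; exact: le_exp2.
apply: (self_contracted_finite_length p (Num.sqrt E + `|z|) p_self) => i.
rewrite -[p i](subrK z) (le_trans (ler_normD _ _)) // lerD2r.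
rewrite -(@ler_sqr R) ?nnegrE ?sqrtr_ge0 //.
have E0 : 0 <= E := le_trans (sqr_ge0 _) (dot_ge_norm _).
rewrite sqr_sqrtr // (le_trans (dot_ge_norm _)) //.
have := flow_energy_gap_le f x f_convex f_diff x_flow z
  1 (2 ^+ i) ltr01 (exp2_ge1 i).
have : 0 <= 2 * (2 ^+ i - 1) * (f (p i) - f z).
  by rewrite !mulr_ge0 ?subr_ge0.
rewrite -/(p i) -/E; lra.
Qed.

Lemma flow_dyadic_energy_summable : exists C, forall n,
  \sum_(i < n) Num.sqrt (2 ^+ i.+1 * (f (p i.+1) - f z)) <= C.
Proof.
have [C pC] := flow_dyadic_finite_length.
have g0 i : 0 <= f (p i) - f z by rewrite subr_ge0.
have tg0 i : 0 <= 2 ^+ i * (f (p i) - f z) by rewrite mulr_ge0 // ltW.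
pose u i := `|p i.+2 - p i|.
pose s i := Num.sqrt (2 ^+ i.+1 * (f (p i.+1) - f z)).
have u0 i : 0 <= u i := normr_ge0 _.
have s0 i : 0 <= s i := sqrtr_ge0 _.
exists (4 * (d.+1%:R * (C + C) + Num.sqrt E)).
apply: (@bounded_sum_of_contraction R s u d.+1%:R (C + C) (Num.sqrt E)) => //.
(* Compare squares: [s i ^+ 2] is the drop term plus half of [s i.+1 ^+ 2], and [1/2 <= (3/4)^2],
   while [d <= d.+1 ^ 2] explains [K]. *)
- move=> i.
  have us0 : 0 <= d.+1%:R * u i + 3 / 4 * s i.+1.
    by rewrite addr_ge0 ?mulr_ge0 ?divr_ge0.
  rewrite -(@ler_sqr R) ?nnegrE //.
  have s2 : s i ^+ 2 = 2 ^+ i.+1 * (f (p i.+1) - f z) by rewrite sqr_sqrtr.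
  have s'2 : s i.+1 ^+ 2 = 2 * 2 ^+ i.+1 * (f (p i.+2) - f z).
    by rewrite sqr_sqrtr // -exprS.
  have drop : 2 ^+ i.+1 * (f (p i.+1) - f (p i.+2)) <= d%:R * u i ^+ 2.
    have := flow_energy_drop_le f x f_convex f_diff x_flow
      (2 ^+ i) (2 ^+ i.+1) (2 ^+ i.+2) (exp2_gt0 i) (le_exp2 _ _ (leqnSn _))
      (le_exp2 _ _ (leqnSn _)).
    rewrite -/(p i) -/(p i.+1) -/(p i.+2).
    have /ler_normlP[_] := normr_dot_le (p i - p i.+2) (p i - p i.+2).
    rewrite distrC -/(u i) -mulrA -expr2.
    have -> : 2 * (2 ^+ i.+1 - 2 ^+ i) = 2 ^+ i.+1 :> R by rewrite exprS; ring.
    by move=> dot_le drop; exact: le_trans drop dot_le.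
  have d_le : d%:R * u i ^+ 2 <= d.+1%:R ^+ 2 * u i ^+ 2.
    rewrite ler_wpM2r ?sqr_ge0 // -natrX ler_nat; lia.
  have : 0 <= d.+1%:R * u i * s i.+1 by rewrite !mulr_ge0.
  have := sqr_ge0 (s i.+1); rewrite sqrrD !exprMn; lra.
- move=> n; apply: (@le_trans _ _ (\sum_(i < n) `|p i.+2 - p i.+1| +
    \sum_(i < n) `|p i.+1 - p i|)).
    rewrite -big_split; apply: ler_sum => i _ /=.
    by rewrite /u -(subrKA (p i.+1)) ler_normD.
  rewrite lerD //; apply: le_trans (pC n.+1).
  by rewrite big_ord_recl /= lerDr.
- move=> i; rewrite s0 /= ler_wsqrtr //.
  have := flow_energy_gap_le f x f_convex f_diff x_flow z
    1 (2 ^+ i.+1) ltr01 (exp2_ge1 _).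
  have := le_trans (sqr_ge0 _) (dot_ge_norm (x (2 ^+ i.+1) - z)).
  (* The gap bound from time 1 has weight [2 * (2 ^+ i.+1 - 1)], which exceeds [2 ^+ i.+1] by this
     first factor. *)
  have : 0 <= (2 ^+ i.+1 - 2) * (f (p i.+1) - f z).
    by rewrite mulr_ge0 // subr_ge0 -[leLHS]expr1 le_exp2.
  rewrite -/(p i.+1) -/E; lra.
Qed.

(** If it failed, then at [t = 2 ^+ i.+1], where [ln t <= i.+1], the squared logarithm would give
    [sqrt e / i.+1 <= s i] for large [i]. *)
Lemma flow_energy_frequently_small (e : R) (N : R) : 0 < e ->
  exists2 t, N < t & t * ln t ^+ 2 * (f (x t) - f z) < e.
Proof.
move=> e0; apply: contrapT => no_t.
have large t : N < t -> e <= t * ln t ^+ 2 * (f (x t) - f z).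
  by move=> Nt; rewrite leNgt; apply/negP => te; apply: no_t; exists t.
have [C sC] := flow_dyadic_energy_summable.
pose s i := Num.sqrt (2 ^+ i.+1 * (f (p i.+1) - f z)).
have se0 : 0 < Num.sqrt e by rewrite sqrtr_gt0.
pose N0 := Num.truncn `|N|.
apply: (@sum_ge_harmonic_unbounded R (fun i => (Num.sqrt e)^-1 * s i) N0
  ((Num.sqrt e)^-1 * C)).
- by move=> i; rewrite mulr_ge0 ?sqrtr_ge0 // invr_ge0 sqrtr_ge0.
- move=> i Ni.
  have N2 : N < 2 ^+ i.+1.
    apply: le_lt_trans (ler_norm _) _.
    have /andP[_ /lt_le_trans -> //] := truncn_itv (normr_ge0 N).
    rewrite -natrX ler_nat (leq_trans _ (ltnW (ltn_expl i.+1 (isT : 1 < 2)%N))) //.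
  have := large _ N2; rewrite lnXn // -/(p i.+1) => e_le.
  have ln2 : ln 2 <= 1 :> R.
    have := @le_ln1Dx R 1; rewrite (_ : 1 + 1 = 2) //; apply; lra.
  have ln2_0 : 0 <= ln 2 :> R by rewrite ln_ge0 // ler1n.
  rewrite /harmonic /= ler_pdivlMl // -ler_pdivlMr ?invr_gt0 // invrK.
  have -> : i.+1%:R = Num.sqrt (i.+1%:R ^+ 2) :> R by rewrite sqrtr_sqr ger0_norm.
  rewrite /s -sqrtrM; last by rewrite mulr_ge0 ?subr_ge0 // ltW.
  apply: ler_wsqrtr; apply: le_trans e_le _.
  rewrite mulrAC ler_wpM2l //; first by rewrite mulr_ge0 ?subr_ge0 // ltW.
  by rewrite -[ln 2 *+ _]mulr_natl exprMn ler_piMr ?sqr_ge0 // expr_le1.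
- by move=> n; rewrite -mulr_sumr ler_pM2l ?invr_gt0.
Qed.

End energy_decay.

Theorem mainTheorem4 (R : realType) (d : nat) (hd : (1 <= d)%N)
    (f : 'rV[R]_d -> R)
    (f_convex : convex_function [set: convex_lmodType 'rV[R]_d] f)
    (f_C1 : C1_function f)
    (f_min : has_minimizer f)
    (x : R -> 'rV[R]_d) (x_flow : is_gradient_flow f x) :
  limf_einf (fun t : R => (t * ln t ^+ 2 * (f (x t) - inf (range f)))%:E)
    (pinfty_nbhs R) = 0%E.
Proof.
have [z z_min] := f_min; have [f_diff _] := f_C1.
have -> : inf (range f) = f z.
  apply/eqP; rewrite eq_le; apply/andP; split.
    by apply: ge_inf; [exists (f z) => _ [q _ <-]|exists z].
  by apply: lb_le_inf; [exists (f z); exists z|move=> _ [q _ <-]].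
(* The liminf is a supremum of infima over neighbourhoods of [+oo]. Each contains a ray beyond some
   [N], hence a time with value below [e]; for the lower bound the ray of positive times
   suffices. *)
rewrite limf_einfE; apply/eqP; rewrite eq_le; apply/andP; split.
  apply: ge_ereal_sup => _ [V [N [_ NV]] <-].
  apply/lee_addgt0Pr => e e0; rewrite add0e.
  have [t Nt te] := flow_energy_frequently_small f x f_convex f_diff x_flow
    z z_min e N e0.
  apply: le_trans (ereal_inf_lbound _) _; first by exists t; [exact: NV|].
  by rewrite lee_fin ltW.
apply: le_trans (ereal_sup_ubound _); last first.
  exists [set t | 0 < t] => //; exists 0; split => //.
apply: le_ereal_inf_tmp => _ [t /= t0 <-].
rewrite lee_fin; apply: mulr_ge0; last by rewrite subr_ge0.
by apply: mulr_ge0; [exact: ltW|exact: sqr_ge0].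
Qed.
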